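(* Let $f,g_i\,(i\in I^g),h_i\,(i\in I^h),G_i,H_i\,(i\in I^{\mathrm{cc}})\colon\mathbb{R}^n\to\mathbb{R}$ be continuously differentiable, where $I^g=\{1,\ldots,m^g\}$, $I^h=\{1,\ldots,m^h\}$, $I^{\mathrm{cc}}=\{1,\ldots,m^{\mathrm{cc}}\}$ with $m^g,m^h\in\mathbb{N}\cup\{0\}$ and $m^{\mathrm{cc}}\in\mathbb{N}$. Let $\bar z$ be a feasible point of the problem $$\text{(MPCC)}\qquad\min\{f(z)\mid g_i(z)\le0\,(i\in I^g),\ h_i(z)=0\,(i\in I^h),\ 0\le G_i(z)\perp H_i(z)\ge0\,(i\in I^{\mathrm{cc}})\},$$ and consider its equivalent reformulation (R) in which each complementarity constraint is replaced by the equality constraint $\min(G_i(z),H_i(z))=0$ ($i\in I^{\mathrm{cc}}$). Then the following assertions hold. (a) The point $\bar z$ is A$\partial^{\mathrm c}$-stationary for (R) if and only if there are sequences $\{z^k\},\{\varepsilon^k\}\subset\mathbb{R}^n$, $\{\lambda^{g,k}\}\subset\mathbb{R}^{m^g}$, $\{\lambda^{h,k}\}\subset\mathbb{R}^{m^h}$, $\{\lambda^{G,k}\},\{\lambda^{H,k}\}\subset\mathbb{R}^{m^{\mathrm{cc}}}$ with $z^k\to\bar z$, $\varepsilon^k\to0$, such that for all $k\in\mathbb{N}$: (i) $\varepsilon^k=\nabla_z\mathcal L^{\mathrm{cc}}(z^k,\lambda^{g,k},\lambda^{h,k},\lambda^{G,k},\lambda^{H,k})$; (ii) $\min(\lambda_i^{g,k},-g_i(\bar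 z))=0$ for all $i\in I^g$; (iii) $\lambda_i^{G,k}=0$ for all $i\in I^{+0}(\bar z)$; (iv) $\lambda_i^{H,k}=0$ for all $i\in I^{0+}(\bar z)$; (v) for all $i\in I^{00}(\bar z)$: if $G_i(z^k)<H_i(z^k)$ then $\lambda_i^{H,k}=0$; if $G_i(z^k)>H_i(z^k)$ then $\lambda_i^{G,k}=0$; if $G_i(z^k)=H_i(z^k)$ then $\lambda_i^{G,k}\lambda_i^{H,k}\ge0$. Particularly, in this situation, $\lambda_i^{G,k}\lambda_i^{H,k}\ge0$ for all $k\in\mathbb{N}$ and $i\in I^{00}(\bar z)$. (b) The point $\bar z$ is A$\partial$-stationary for (R) if and only if there are sequences $\{z^k\},\{\varepsilon^k\}\subset\mathbb{R}^n$, $\{\lambda^{g,k}\}\subset\mathbb{R}^{m^g}$, $\{\lambda^{h,k}\}\subset\mathbb{R}^{m^h}$, $\{\lambda^{G,k}\},\{\lambda^{H,k}\}\subset\mathbb{R}^{m^{\mathrm{cc}}}$ with $z^k\to\bar z$, $\varepsilon^k\to0$, such that for all $k\in\mathbb{N}$ conditions (i)–(iv) hold and, for all $i\in I^{00}(\bar z)$: if $G_i(z^k)<H_i(z^k)$ then $\lambda_i^{H,k}=0$; if $G_i(z^k)>H_i(z^k)$ then $\lambda_i^{G,k}=0$; if $G_i(z^k)=H_i(z^k)$ then ($\lambda_i^{G,k}<0$ and $\lambda_i^{H,k}<0$) or $\lambda_i^{G,k}\lambda_i^{H,k}=0$. Particularly, in this situation, for all $k\in\mathbb{N}$ and $i\in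 I^{00}(\bar z)$, ($\lambda_i^{G,k}<0$ and $\lambda_i^{H,k}<0$) or $\lambda_i^{G,k}\lambda_i^{H,k}=0$.
   Context: $0\le a\perp b\ge0$ means $a\ge0$, $b\ge0$, $ab=0$. With $g,h,G,H$ the vector functions having the components $g_i,h_i,G_i,H_i$, the MPCC-Lagrangian is $$\mathcal L^{\mathrm{cc}}(z,\lambda^g,\lambda^h,\lambda^G,\lambda^H)=f(z)+(\lambda^g)^\top g(z)+(\lambda^h)^\top h(z)+(\lambda^G)^\top G(z)+(\lambda^H)^\top H(z).$$ Index sets: $I^{+0}(\bar z)=\{i\in I^{\mathrm{cc}}\mid G_i(\bar z)>0,\,H_i(\bar z)=0\}$, $I^{0+}(\bar z)=\{i\in I^{\mathrm{cc}}\mid G_i(\bar z)=0,\,H_i(\bar z)>0\}$, $I^{00}(\bar z)=\{i\in I^{\mathrm{cc}}\mid G_i(\bar z)=H_i(\bar z)=0\}$. Subdifferentials: for a closed set $A\subset\mathbb{R}^n$ and $\bar z\in A$, the regular normal cone is $\widehat{\mathcal N}_A(\bar z)=\{\xi\mid \forall z\in A:\ \xi^\top(z-\bar z)\le o(\|z-\bar z\|)\}$ and the limiting normal cone $\mathcal N_A(\bar z)$ is the set of all limits of sequences $\xi^k\in\widehat{\mathcal N}_A(z^k)$ with $z^k\in A$, $z^k\to\bar z$. For $\psi$ locally Lipschitz continuous at $\bar z$, the limiting subdifferential is $\partial\psi(\bar z)=\{\xi\mid(\xi,-1)\in\mathcal N_{\operatorname{epi}\psi}(\bar z,\psi(\bar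 z))\}$ and the Clarke subdifferential is $\partial^{\mathrm c}\psi(\bar z)=\operatorname{conv}\partial\psi(\bar z)$. Asymptotic stationarity: let $\partial^\square$ be $\partial$ or $\partial^{\mathrm c}$. For a problem $\min\{\varphi_0(z)\mid\varphi_i(z)\le0\,(i\in I),\ \varphi_i(z)=0\,(i\in J)\}$ with locally Lipschitz data, $I=\{1,\ldots,p\}$, $J=\{p+1,\ldots,p+q\}$, a feasible point $\bar z$ is A$\partial^\square$-stationary if there are sequences $\{z^k\},\{\varepsilon^k\}\subset\mathbb{R}^n$, $\{\lambda^k\}\subset\mathbb{R}^{p+q}$ with $z^k\to\bar z$, $\varepsilon^k\to0$ and, for all $k\in\mathbb{N}$, $$\varepsilon^k\in\partial\varphi_0(z^k)+\sum_{i\in I}\lambda_i^k\,\partial^\square\varphi_i(z^k)+\sum_{i\in J}\lambda_i^k\bigl(\partial^\square\varphi_i(z^k)\cup\partial^\square(-\varphi_i)(z^k)\bigr),$$ $\min(\lambda_i^k,-\varphi_i(\bar z))=0$ ($i\in I$), and $\lambda_i^k\ge0$ ($i\in J$). For (R), the objective is $f$, the inequality constraint functions are the $g_i$, and the equality constraint functions are the $h_i$ together with $z\mapsto\min(G_i(z),H_i(z))$. *)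

(* Defs.v *)
From HB Require Import structures.
From mathcomp Require Import all_boot all_order all_algebra.
From mathcomp Require Import all_classical all_reals all_analysis.

Set Implicit Arguments.
Unset Strict Implicit.
Unset Printing Implicit Defensive.

Import Order.TTheory GRing.Theory Num.Theory.
Import numFieldNormedType.Exports.

Local Open Scope classical_set_scope.
Local Open Scope ring_scope.

Section Subdifferentials.
Context {R : realType}.

Definition dotv n (u v : 'rV[R]_n) : R := \sum_(i < n) u 0 i * v 0 i.

Definition grad n (phi : 'rV[R]_n -> R) (z : 'rV[R]_n) : 'rV[R]_n :=
  \row_(j < n) 'D_(delta_mx 0 j) phi z.

Definition C1 n (phi : 'rV[R]_n -> R) : Prop :=
  (forall z, differentiable phi z) /\ continuous (grad phi).

(* [`|y - z|] is the sup norm of ['rV[R]_n]; since all norms on R^n are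
   equivalent, the condition [<= o(|y - z|)] is the Euclidean one. *)
Definition regular_normal_cone n (A : set 'rV[R]_n) (z : 'rV[R]_n) :
    set 'rV[R]_n :=
  [set xi | forall e : R, 0 < e ->
     \forall y \near z, A y -> dotv xi (y - z) <= e * `|y - z|].

Definition limiting_normal_cone n (A : set 'rV[R]_n) (z : 'rV[R]_n) :
    set 'rV[R]_n :=
  [set xi | exists (y zeta : nat -> 'rV[R]_n),
     [/\ forall k, A (y k),
         forall k, regular_normal_cone A (y k) (zeta k),
         y @ \oo --> z & zeta @ \oo --> xi]].

(* R^n x R is represented by ['rV[R]_(n + 1)]: the pair (z, t) is
   [row_mx z t%:M]. *)
Definition epi n (psi : 'rV[R]_n -> R) : set 'rV[R]_(n + 1) :=
  [set p | psi (lsubmx p) <= rsubmx p 0 0].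

Definition limiting_subdiff {n} (psi : 'rV[R]_n -> R) (z : 'rV[R]_n) :
    set 'rV[R]_n :=
  [set xi | limiting_normal_cone (epi psi)
              (row_mx z (psi z)%:M) (row_mx xi (-1)%:M)].

Definition convex_hull n (A : set 'rV[R]_n) : set 'rV[R]_n :=
  smallest (@convex_set R 'rV[R]_n) A.

Definition clarke_subdiff {n} (psi : 'rV[R]_n -> R) (z : 'rV[R]_n) :
    set 'rV[R]_n :=
  convex_hull (limiting_subdiff psi z).

End Subdifferentials.

Section AsymptoticStationarity.
Context {R : realType}.

Record problem (n p q : nat) := Problem {
  objective : 'rV[R]_n -> R;
  ineq : 'I_p -> 'rV[R]_n -> R;
  eqty : 'I_q -> 'rV[R]_n -> R }.

Definition feasible n p q (P : problem n p q) (z : 'rV[R]_n) : Prop :=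
  (forall i, ineq P i z <= 0) /\ (forall j, eqty P j z = 0).

(* The subdifferential [sd] is used for the constraint functions only: the
   objective always contributes its limiting subdifferential.  The multiplier
   vector of R^(p+q) is split into its inequality part [lamI] and its equality
   part [lamJ]; [xi0], [xiI], [xiJ] witness membership in the Minkowski sum. *)
Definition asymptotically_stationary n p q
    (sd : ('rV[R]_n -> R) -> 'rV[R]_n -> set 'rV[R]_n)
    (P : problem n p q) (zbar : 'rV[R]_n) : Prop :=
  feasible P zbar /\
  exists (z eps : nat -> 'rV[R]_n)
         (lamI : nat -> 'rV[R]_p) (lamJ : nat -> 'rV[R]_q),
    [/\ z @ \oo --> zbar,
        eps @ \oo --> (0 : 'rV[R]_n) &
        forall k : nat,
          [/\ exists (xi0 : 'rV[R]_n) (xiI : 'I_p -> 'rV[R]_n)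
                     (xiJ : 'I_q -> 'rV[R]_n),
                [/\ limiting_subdiff (objective P) (z k) xi0,
                    forall i, sd (ineq P i) (z k) (xiI i),
                    forall j, (sd (eqty P j) (z k) `|`
                               sd (fun y => - eqty P j y) (z k)) (xiJ j) &
                    eps k = xi0 + \sum_(i < p) lamI k 0 i *: xiI i
                                + \sum_(j < q) lamJ k 0 j *: xiJ j],
              forall i, Num.min (lamI k 0 i) (- ineq P i zbar) = 0 &
              forall j, 0 <= lamJ k 0 j]].

End AsymptoticStationarity.

Section MPCC.
Context {R : realType} {n mg mh mcc : nat}.
Variables (f : 'rV[R]_n -> R) (g : 'I_mg -> 'rV[R]_n -> R)
          (h : 'I_mh -> 'rV[R]_n -> R) (G H : 'I_mcc -> 'rV[R]_n -> R).

Definition mpcc_feasible (z : 'rV[R]_n) : Prop :=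
  [/\ forall i, g i z <= 0,
      forall i, h i z = 0 &
      forall i, [/\ 0 <= G i z, 0 <= H i z & G i z * H i z = 0]].

Definition reformulation : problem n mg (mh + mcc) :=
  {| objective := f;
     ineq := g;
     eqty := fun j => match fintype.split j with
                      | inl i => h i
                      | inr i => fun z => Num.min (G i z) (H i z)
                      end |}.

Definition mpcc_lagrangian (z : 'rV[R]_n) (lg : 'rV[R]_mg) (lh : 'rV[R]_mh)
    (lG lH : 'rV[R]_mcc) : R :=
  f z + \sum_(i < mg) lg 0 i * g i z + \sum_(i < mh) lh 0 i * h i z
      + \sum_(i < mcc) lG 0 i * G i z + \sum_(i < mcc) lH 0 i * H i z.

Definition I_p0 (z : 'rV[R]_n) : set 'I_mcc :=
  [set i | 0 < G i z /\ H i z = 0].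

Definition I_0p (z : 'rV[R]_n) : set 'I_mcc :=
  [set i | G i z = 0 /\ 0 < H i z].

Definition I_00 (z : 'rV[R]_n) : set 'I_mcc :=
  [set i | G i z = 0 /\ H i z = 0].

(* [biactive a b] is the requirement put on the multipliers (a, b) of a
   biactive pair (G_i, H_i) at an iterate where G_i and H_i coincide. *)
Definition mpcc_sequences (biactive : R -> R -> Prop) (zbar : 'rV[R]_n)
    (z eps : nat -> 'rV[R]_n) (lg : nat -> 'rV[R]_mg) (lh : nat -> 'rV[R]_mh)
    (lG lH : nat -> 'rV[R]_mcc) : Prop :=
  [/\ z @ \oo --> zbar,
      eps @ \oo --> (0 : 'rV[R]_n) &
      forall k : nat,
        [/\ eps k = grad (fun y => mpcc_lagrangian y (lg k) (lh k) (lG k) (lH k))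
                         (z k),
            forall i, Num.min (lg k 0 i) (- g i zbar) = 0,
            forall i, I_p0 zbar i -> lG k 0 i = 0,
            forall i, I_0p zbar i -> lH k 0 i = 0 &
            forall i, I_00 zbar i ->
              [/\ G i (z k) < H i (z k) -> lH k 0 i = 0,
                  G i (z k) > H i (z k) -> lG k 0 i = 0 &
                  G i (z k) = H i (z k) -> biactive (lG k 0 i) (lH k 0 i)]]].

End MPCC.

Definition nonneg_product {R : realType} (a b : R) : Prop := 0 <= a * b.

Definition both_negative_or_zero_product {R : realType} (a b : R) : Prop :=
  (a < 0 /\ b < 0) \/ a * b = 0.

(* Main.v *)
Require Import Defs.
From HB Require Import structures.
From mathcomp Require Import all_boot all_order all_algebra.
From mathcomp Require Import all_classical all_reals all_analysis.
From mathcomp Require Import ring lra.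

Set Implicit Arguments.
Unset Strict Implicit.
Unset Printing Implicit Defensive.

Import Order.TTheory GRing.Theory Num.Theory.
Import numFieldNormedType.Exports.

Local Open Scope classical_set_scope.
Local Open Scope ring_scope.

(** Both assertions are one statement about two subdifferentials. In the
    A-stationarity condition of the reformulation, the constraint functions
    contribute arbitrary nonnegative multiples of elements of the subdifferential
    of [psi] or of [- psi], for every equality constraint [psi = 0]. The proof
    computes the set of these contributions ([equality_terms]).

    - For a C1 function [phi] the subdifferential is the singleton of the
      gradient, so that the contributions of [phi = 0] are all real multiples of
      [grad phi]: the sign restriction is absorbed by passing to [- phi].
    - For [psi = min(G, H)] at a point where [G] and [H] differ, [psi] agrees
      locally with the smaller function, and the previous case applies; the
      multiplier of the larger function is zero.
    - At a point where [G = H], the limiting subdifferential of [min(G, H)] is the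
      pair of both gradients, whereas that of [- min(G, H) = max(- G, - H)] is the
      whole segment between the negated gradients. Nonnegative multiples of the
      pair give multipliers [(a, 0)] and [(0, b)] with [a, b >= 0], those of the
      segment all pairs with [a, b <= 0]; together these are the pairs with both
      entries negative or zero product. The Clarke subdifferential replaces the
      pair by its segment and hence adds the pairs with [a, b >= 0], so that
      the condition becomes [0 <= a * b].

    Given this ([limiting_kink_consistent], [clarke_kink_consistent]), the
    stationarity systems of the two problems agree at each iterate, except that at
    indices with [G_i(zbar) > 0 = H_i(zbar)] or the reverse the reformulation
    looks at the order of [G_i] and [H_i] at the iterate. By continuity that order
    is the one at [zbar] from some iterate on, so that it suffices to drop finitely
    many terms of the sequences ([asymptotically_stationary_mpcc]).

    The subdifferentials are computed from the epigraph definition. A regular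
    normal [(xi, - b)] with [b > 0] to the epigraph of [psi] can only sit on the
    graph, and [b^-1 *: xi] is then bounded in every direction by each upper
    bound of the upper Dini derivative of [psi]
    ([epi_normal_dini_subgradient]). Limiting subgradients are limits of such
    vectors ([limiting_subdiff_dini]), which gives the upper estimates. The lower
    estimates come from regular subgradients at nearby points
    ([cvg_regular_subgradient]). *)

(** * Inner product, sup norm and gradients *)

Section InnerProduct.
Context {R : realType} {n : nat}.
Implicit Types u v w : 'rV[R]_n.

Lemma dotvC u v : dotv u v = dotv v u.
Proof. by apply: eq_bigr => i _; rewrite mulrC. Qed.

Lemma dotvDl u v w : dotv (u + v) w = dotv u w + dotv v w.
Proof. by rewrite -big_split; apply: eq_bigr => i _; rewrite mxE mulrDl. Qed.

Lemma dotvZl (a : R) u v : dotv (a *: u) v = a * dotv u v.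
Proof. by rewrite mulr_sumr; apply: eq_bigr => i _; rewrite mxE mulrA. Qed.

Lemma dot0v v : dotv 0 v = 0.
Proof. by apply: big1 => i _; rewrite mxE mul0r. Qed.

Lemma dotv0 u : dotv u 0 = 0.
Proof. by rewrite dotvC dot0v. Qed.

Lemma dotvNl u v : dotv (- u) v = - dotv u v.
Proof. by rewrite -scaleN1r dotvZl mulN1r. Qed.

Lemma dotvBl u v w : dotv (u - v) w = dotv u w - dotv v w.
Proof. by rewrite dotvDl dotvNl. Qed.

Lemma dotvZr (a : R) u v : dotv u (a *: v) = a * dotv u v.
Proof. by rewrite dotvC dotvZl dotvC. Qed.

Lemma dotvNr u v : dotv u (- v) = - dotv u v.
Proof. by rewrite dotvC dotvNl dotvC. Qed.

Lemma dotvBr u v w : dotv u (v - w) = dotv u v - dotv u w.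
Proof. by rewrite dotvC dotvBl ![dotv _ u]dotvC. Qed.

Lemma dotvv_ge0 u : 0 <= dotv u u.
Proof. by apply: sumr_ge0 => i _; rewrite -expr2 sqr_ge0. Qed.

Lemma dotvv_le0 u : dotv u u <= 0 -> u = 0.
Proof.
move=> u_le0; have /eqP : dotv u u = 0 by apply/le_anti; rewrite u_le0 dotvv_ge0.
rewrite psumr_eq0 => [/allP u0|i _]; last by rewrite -expr2 sqr_ge0.
apply/rowP => i; rewrite mxE; apply/eqP.
by have := u0 i (mem_index_enum _); rewrite mulf_eq0 orbb.
Qed.

Lemma dotv_row_mx u v (s t : R) :
  dotv (row_mx u s%:M) (row_mx v t%:M) = dotv u v + s * t.
Proof.
rewrite /dotv big_split_ord /= big_ord1; congr (_ + _).
  by apply: eq_bigr => i _; rewrite !row_mxEl.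
by rewrite !row_mxEr !mxE !mulr1n.
Qed.

Lemma cvg_dotv (x y : nat -> 'rV[R]_n) u v :
  x @ \oo --> u -> y @ \oo --> v -> (fun k => dotv (x k) (y k)) @ \oo --> dotv u v.
Proof.
move=> xu yv; apply: cvg_big => [|i _]; first exact: (@add_continuous R^o).
apply: cvgM.
  exact: (cvg_comp _ _ xu (@coord_continuous _ _ _ 0 i u)).
exact: (cvg_comp _ _ yv (@coord_continuous _ _ _ 0 i v)).
Qed.

End InnerProduct.

Section SupNorm.
Context {R : realType}.

Lemma normr_coord_le m n (A : 'M[R]_(m, n)) i j : `|A i j| <= `|A|.
Proof.
rewrite [leRHS]/Num.Def.normr /= mx_normrE.
exact: (le_bigmax _ (fun ij : 'I_m * 'I_n => `|A ij.1 ij.2|) (i, j)).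
Qed.

Lemma normr_lsubmx_le m n1 n2 (A : 'M[R]_(m, n1 + n2)) : `|lsubmx A| <= `|A|.
Proof.
rewrite [leLHS]/Num.Def.normr /= mx_normrE bigmax_le // => -[i j] _ /=.
by rewrite mxE normr_coord_le.
Qed.

Lemma near_always n (z : 'rV[R]_n) (P : set 'rV[R]_n) :
  (forall y, P y) -> \forall y \near z, P y.
Proof. exact: (@nearW _ _ _ (nbhs_filter z)). Qed.

Lemma lsubmx_continuous m n1 n2 : continuous (@lsubmx R m n1 n2).
Proof.
move=> A; apply/(@cvgrPdist_lt _ _ _ (nbhs A) (nbhs_filter A)) => e e0.
apply: (@filterS _ _ (nbhs_filter A)) (nbhsx_ballx A e e0) => B.
rewrite -ball_normE /= -linearB /=; exact/le_lt_trans/normr_lsubmx_le.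
Qed.

Lemma cvg_row_mx n (x : nat -> 'rV[R]_n) (t : nat -> R) z s :
  x @ \oo --> z -> t @ \oo --> s ->
  (fun k => row_mx (x k) (t k)%:M : 'rV[R]_(n + 1)) @ \oo --> row_mx z s%:M.
Proof.
move=> xz ts; apply/cvgrPdist_le => e e0; near=> k.
have xk : `|z - x k| <= e by near: k; exact: cvgr_dist_le.
have tk : `|s - t k| <= e by near: k; exact: cvgr_dist_le.
rewrite [leLHS]/Num.Def.normr /= mx_normrE bigmax_le ?ltW // => -[i j] _ /=.
rewrite ord1 !mxE; case: splitP => j' _.
  by have := normr_coord_le (z - x k) 0 j'; rewrite !mxE => /le_trans; apply.
by rewrite !mxE ord1 !mulr1n.
Unshelve. all: by end_near. Qed.

End SupNorm.

Section Gradients.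
Context {R : realType} {n : nat}.
Implicit Types (phi psi : 'rV[R]_n -> R) (x z d : 'rV[R]_n).

Lemma diff_dotv_grad {phi x} d :
  differentiable phi x -> 'd phi x d = dotv (grad phi x) d.
Proof.
move=> dphi; rewrite {1}(row_sum_delta d) linear_sum; apply: eq_bigr => i _.
by rewrite linearZ /= mxE deriveE // mulrC.
Qed.

Lemma grad_first_order {phi x} (e : R) : differentiable phi x -> 0 < e ->
  \forall y \near x, `|phi y - phi x - dotv (grad phi x) (y - x)| <= e * `|y - x|.
Proof.
move=> dphi e0.
have /eqaddoP /(_ _ e0) : phi \o shift x = cst (phi x) + 'd phi x +o_ (0 : 'rV[R]_n) id.
  exact: diff_locally.
rewrite [in X in _ -> X](near_shift 0) subr0 => h; near=> y.
rewrite /= addrK -diff_dotv_grad //.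
have : `|(phi \o shift x - (cst (phi x) + 'd phi x)) y| <= e * `|y| by near: y.
by rewrite /= opprD addrA.
Unshelve. all: by end_near. Qed.

Lemma gradD {phi psi x} : differentiable phi x -> differentiable psi x ->
  grad (phi \+ psi) x = grad phi x + grad psi x.
Proof.
by move=> dphi dpsi; apply/rowP => j; rewrite !mxE deriveD //; exact: diff_derivable.
Qed.

Lemma gradZ (a : R) {phi x} : differentiable phi x ->
  grad (fun y => a * phi y) x = a *: grad phi x.
Proof.
by move=> dphi; apply/rowP => j; rewrite !mxE (deriveZ (f := phi)) //; exact: diff_derivable.
Qed.

Lemma gradN {phi x} : differentiable phi x ->
  grad (fun y => - phi y) x = - grad phi x.
Proof.
by move=> dphi; apply/rowP => j; rewrite !mxE (deriveN (f := phi)) //; exact: diff_derivable.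
Qed.

Lemma C1N phi : C1 phi -> C1 (fun y => - phi y).
Proof.
move=> [dphi cphi]; split=> [z|z]; first exact: differentiableN.
rewrite [X in continuous_at _ X](_ : _ = fun y => - grad phi y).
  exact: cvgN (cphi z).
by apply/funext => y; rewrite gradN.
Qed.

Lemma C1_continuous phi : C1 phi -> continuous phi.
Proof. by move=> [dphi _] z; exact: differentiable_continuous. Qed.

End Gradients.

(** * Normals to epigraphs *)

Section DiniSubgradients.
Context {R : realType} {n : nat}.
Implicit Types (phi psi : 'rV[R]_n -> R) (x z d xi : 'rV[R]_n).

(** [m] bounds the upper Dini derivative of [psi] at [x] in direction [d]. Working
    with bounds rather than with the derivative avoids any question of its
    existence or finiteness. *)
Definition upper_dini psi x d (m : R) : Prop :=
  forall e : R, 0 < e ->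
    \forall s \near (0 : R)^'+, psi (x + s *: d) <= psi x + s * (m + e).

(** A directional relaxation of [regular_subgradient]: it is tested against upper
    bounds on the growth of [psi] along rays, which are easy to compute for minima
    and maxima of smooth functions. *)
Definition dini_subgradient psi x xi : Prop :=
  forall d (m : R), upper_dini psi x d m -> dotv xi d <= m.

(** The condition that [(xi, -1)] is a regular normal to the epigraph at the graph
    point over [x], in terms of the values of [psi]. *)
Definition regular_subgradient psi x xi : Prop :=
  forall e : R, 0 < e ->
    \forall y \near x, psi x + dotv xi (y - x) - e * `|y - x| <= psi y.

End DiniSubgradients.

Section Normals.
Context {R : realType}.

Lemma near_ray k (p v : 'rV[R]_k) (P : set 'rV[R]_k) :
  (\forall q \near p, P q) -> \forall s \near (0 : R)^'+, P (p + s *: v).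
Proof.
move=> Pp; have : p + s *: v @[s --> (0 : R)^'+] --> p + (0 : R) *: v.
  apply: cvgD; first exact: cvg_cst.
  by apply: cvgZr_tmp; apply: cvg_at_right_filter; exact: cvg_id.
by rewrite scale0r addr0; exact.
Qed.

(** Along a ray, [dotv zeta (s *: v)] and [`|s *: v|] are both linear in [s], so
    that the little-o in the definition of a regular normal disappears. *)
Lemma regular_normal_ray k (A : set 'rV[R]_k) (p v zeta : 'rV[R]_k) :
  regular_normal_cone A p zeta ->
  (\forall s \near (0 : R)^'+, A (p + s *: v)) -> dotv zeta v <= 0.
Proof.
move=> zetaN Av; rewrite leNgt; apply/negP => c_gt0.
have v1_gt0 : 0 < `|v| + 1 by rewrite ltr_wpDl.
(* With this tolerance the normal inequality reads [`|v| + 1 <= `|v|]. *)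
have e_gt0 : 0 < dotv zeta v / (`|v| + 1) by rewrite divr_gt0.
have zetav : \forall s \near (0 : R)^'+,
    A (p + s *: v) -> dotv zeta (s *: v) <= dotv zeta v / (`|v| + 1) * `|s *: v|.
  have := near_ray v (zetaN _ e_gt0).
  by apply: filterS => s; rewrite [p + _]addrC addrK.
near (0 : R)^'+ => s.
have s_gt0 : 0 < s by near: s; exact: nbhs_right_gt.
have As : A (p + s *: v) by near: s.
have : A (p + s *: v) ->
    dotv zeta (s *: v) <= dotv zeta v / (`|v| + 1) * `|s *: v| by near: s.
move=> /(_ As); rewrite dotvZr normrZ gtr0_norm // mulrCA ler_pM2l //.
by rewrite -mulrA ler_pMr // mulrC ler_pdivlMr // mul1r gerDl ler10.
Unshelve. all: by end_near. Qed.

End Normals.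

Section EpigraphNormals.
Context {R : realType} {n : nat}.
Implicit Types (phi psi : 'rV[R]_n -> R) (x z d xi : 'rV[R]_n).

Lemma epi_row_mx psi x (t : R) : epi psi (row_mx x t%:M) = (psi x <= t).
Proof. by rewrite /epi /= row_mxKl row_mxKr mxE mulr1n. Qed.

Lemma row_mx_ray x d (s t r : R) :
  row_mx x t%:M + s *: row_mx d r%:M = row_mx (x + s *: d) (t + s * r)%:M
    :> 'rV[R]_(n + 1).
Proof. by rewrite scale_row_mx add_row_mx scale_scalar_mx [(t + _)%:M]raddfD. Qed.

(** If the base point were strictly above the graph, the epigraph would contain a
    ray pointing down from it, against [b > 0]; so it is on the graph. The
    estimate then tests the normal against the rays with directions
    [(d, m + e)], which enter the epigraph because [m] is an upper Dini bound. *)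
Lemma epi_normal_dini_subgradient psi x xi (t b : R) :
  epi psi (row_mx x t%:M) ->
  regular_normal_cone (epi psi) (row_mx x t%:M) (row_mx xi (- b)%:M) ->
  0 < b -> dini_subgradient psi x (b^-1 *: xi).
Proof.
rewrite epi_row_mx => tx xiN b0 d m dm.
have {}tx : t = psi x.
  apply/eqP; rewrite eq_le tx andbT leNgt; apply/negP => xt.
  suff : dotv (row_mx xi (- b)%:M) (row_mx 0 (- 1)%:M) <= 0.
    rewrite dotv_row_mx dotv0 add0r mulrNN mulr1.
    by rewrite leNgt b0.
  apply: (regular_normal_ray xiN); near=> s.
  rewrite row_mx_ray epi_row_mx scaler0 addr0 mulrN1 lerBrDr -lerBrDl ltW //.
  by near: s; apply: nbhs_right_lt; rewrite subr_gt0.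
rewrite tx in xiN; apply/ler_addgt0Pr => e e0.
have : dotv (row_mx xi (- b)%:M) (row_mx d (m + e)%:M) <= 0.
  apply: (regular_normal_ray xiN); have := dm _ e0.
  by apply: filterS => s; rewrite row_mx_ray epi_row_mx.
by rewrite dotv_row_mx dotvZl mulNr subr_le0 ler_pdivrMl.
Unshelve. all: by end_near. Qed.

(** The last coordinates of the normals tend to [-1], so that they are eventually
    negative and the normals can be rescaled without changing the limit. *)
Lemma limiting_subdiff_dini psi z xi : limiting_subdiff psi z xi ->
  exists x u : nat -> 'rV[R]_n,
    [/\ x @ \oo --> z, u @ \oo --> xi &
        \forall k \near \oo, dini_subgradient psi (x k) (u k)].
Proof.
case=> y [zeta [yA yN yz zetaxi]].
have lsub_cvg (w : nat -> 'rV[R]_(n + 1)) a (r : R) :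
    w @ \oo --> row_mx a r%:M -> (fun k => lsubmx (w k)) @ \oo --> a.
  move=> wa; rewrite -[X in _ --> X](row_mxKl a r%:M).
  exact: (cvg_comp _ _ wa (@lsubmx_continuous _ _ _ _ _)).
have rsub_cvg : (fun k => - rsubmx (zeta k) 0 0) @ \oo --> (1 : R).
  rewrite -[X in _ --> X]opprK; apply: cvgN.
  rewrite [X in X @ _](_ : _ = fun k => zeta k 0 (rshift n 0)); last first.
    by apply/funext => k; rewrite mxE.
  have := cvg_comp _ _ zetaxi (@coord_continuous _ _ _ 0 (rshift n 0) _).
  by rewrite row_mxEr mxE mulr1n.
exists (fun k => lsubmx (y k)).
exists (fun k => (- rsubmx (zeta k) 0 0)^-1 *: lsubmx (zeta k)); split.
- exact: lsub_cvg yz.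
- have := cvgZ (cvgV (oner_neq0 R) rsub_cvg) (lsub_cvg _ _ _ zetaxi).
  by rewrite invr1 scale1r; apply.
- near=> k.
  have row_mx_eta (w : 'rV[R]_(n + 1)) :
      row_mx (lsubmx w) (rsubmx w 0 0)%:M = w by rewrite -mx11_scalar hsubmxK.
  apply: (@epi_normal_dini_subgradient _ _ _ (rsubmx (y k) 0 0)).
  + by rewrite row_mx_eta.
  + by rewrite opprK !row_mx_eta.
  + by near: k; apply: (cvgr_gt _ rsub_cvg); exact: ltr01.
Unshelve. all: by end_near. Qed.

(** A point of the epigraph lies above the graph, and the first block of a vector
    is bounded by the vector in sup norm; hence the inequality on the graph
    implies the one on the epigraph. *)
Lemma regular_subgradient_epi_normal psi x xi :
  regular_subgradient psi x xi ->
  regular_normal_cone (epi psi) (row_mx x (psi x)%:M) (row_mx xi (- 1)%:M).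
Proof.
move=> xisub e e0.
have lsub_cvg : @lsubmx R 1 n 1 p @[p --> row_mx x (psi x)%:M] --> x.
  have := @lsubmx_continuous R 1 n 1 (row_mx x (psi x)%:M).
  by rewrite /continuous_at row_mxKl.
apply: (@filterS _ _ (nbhs_filter _)) (lsub_cvg _ (xisub e e0)) => p /= xip pA.
have pE : p - row_mx x (psi x)%:M =
    row_mx (lsubmx p - x) (rsubmx p 0 0 - psi x)%:M.
  rewrite -{1}[p]hsubmxK {1}[rsubmx p]mx11_scalar opp_row_mx add_row_mx.
  by rewrite [in RHS]raddfB.
rewrite [in leLHS]pE dotv_row_mx.
have : e * `|lsubmx p - x| <= e * `|p - row_mx x (psi x)%:M|.
  rewrite ler_pM2l // -[X in lsubmx p - X](row_mxKl x (psi x)%:M) -raddfB.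
  exact: normr_lsubmx_le.
move: pA xip; rewrite /epi /=; lra.
Qed.

Lemma cvg_regular_subgradient psi z xi (x u : nat -> 'rV[R]_n) :
  x @ \oo --> z -> (fun k => psi (x k)) @ \oo --> psi z -> u @ \oo --> xi ->
  (forall k, regular_subgradient psi (x k) (u k)) -> limiting_subdiff psi z xi.
Proof.
move=> xz psixz uxi usub.
exists (fun k => row_mx (x k) (psi (x k))%:M), (fun k => row_mx (u k) (- 1)%:M).
split=> [k|k||].
- by rewrite epi_row_mx.
- exact: regular_subgradient_epi_normal.
- exact: cvg_row_mx.
- by apply: cvg_row_mx => //; exact: cvg_cst.
Qed.

Lemma regular_subgradient_limiting psi z xi :
  regular_subgradient psi z xi -> limiting_subdiff psi z xi.
Proof.
move=> xisub; apply: (@cvg_regular_subgradient _ _ _ (cst z) (cst xi)) => //.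
- exact: cvg_cst.
- by rewrite /=; exact: (cvg_cst (psi z)).
- exact: cvg_cst.
Qed.

End EpigraphNormals.

(** * Calculus of Dini subgradients *)

Section DiniCalculus.
Context {R : realType} {n : nat}.
Implicit Types (phi psi : 'rV[R]_n -> R) (x z d xi : 'rV[R]_n).

Lemma upper_dini_majorant phi psi x d m : psi x = phi x ->
  (\forall y \near x, psi y <= phi y) ->
  upper_dini phi x d m -> upper_dini psi x d m.
Proof.
move=> psix psi_le phi_dini e e0; near=> s; rewrite psix.
apply: (@le_trans _ _ (phi (x + s *: d))); last by near: s; exact: phi_dini.
by near: s; exact: (near_ray d psi_le).
Unshelve. all: by end_near. Qed.

Lemma differentiable_upper_dini phi x d :
  differentiable phi x -> upper_dini phi x d (dotv (grad phi x) d).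
Proof.
move=> dphi e e0; have d1_gt0 : 0 < `|d| + 1 by rewrite ltr_wpDl.
(* The denominator absorbs [`|d|], plus one in case the direction vanishes. *)
have e'_gt0 : 0 < e / (`|d| + 1) by rewrite divr_gt0.
near=> s; have s_gt0 : 0 < s by near: s; exact: nbhs_right_gt.
have : `|phi (x + s *: d) - phi x - dotv (grad phi x) (x + s *: d - x)| <=
       e / (`|d| + 1) * `|x + s *: d - x|.
  near: s; exact: (near_ray d (grad_first_order dphi e'_gt0)).
rewrite [x + _ - x]addrC addKr dotvZr normrZ gtr0_norm //.
have : e / (`|d| + 1) * (s * `|d|) <= s * e.
  rewrite mulrCA ler_pM2l // -mulrA ler_piMr ?(ltW e0) // mulrC ler_pdivrMr //.
  by rewrite mul1r lerDl.
by rewrite ler_norml mulrDr => ? /andP[]; lra.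
Unshelve. all: by end_near. Qed.

Lemma upper_dini_max phi psi x d (a b : R) : phi x = psi x ->
  upper_dini phi x d a -> upper_dini psi x d b ->
  upper_dini (fun y => Num.max (phi y) (psi y)) x d (Num.max a b).
Proof.
move=> phix phi_dini psi_dini e e0; near=> s.
have s_gt0 : 0 < s by near: s; exact: nbhs_right_gt.
have le_maxD c : c <= Num.max a b -> s * (c + e) <= s * (Num.max a b + e).
  by move=> c_le; rewrite ler_pM2l // lerD2r.
rewrite -phix maxxx ge_max; apply/andP; split.
  have : phi (x + s *: d) <= phi x + s * (a + e) by near: s; exact: phi_dini.
  by move/le_trans; apply; rewrite lerD2l le_maxD // le_max lexx.
have : psi (x + s *: d) <= psi x + s * (b + e) by near: s; exact: psi_dini.
by move/le_trans; apply; rewrite -phix lerD2l le_maxD // le_max lexx orbT.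
Unshelve. all: by end_near. Qed.

(** A smooth function that touches [psi] from above makes [xi - grad phi x]
    nonpositive in every direction, in particular in its own. *)
Lemma dini_subgradient_majorant phi psi x xi : differentiable phi x ->
  psi x = phi x -> (\forall y \near x, psi y <= phi y) ->
  dini_subgradient psi x xi -> xi = grad phi x.
Proof.
move=> dphi psix psi_le xisub; apply/eqP; rewrite -subr_eq0; apply/eqP.
apply: dotvv_le0; rewrite dotvBl subr_le0; apply: xisub.
exact: upper_dini_majorant (differentiable_upper_dini _ dphi).
Qed.

Definition segment (a b : 'rV[R]_n) : set 'rV[R]_n :=
  [set xi | exists2 t : R, 0 <= t <= 1 & xi = t *: a + (1 - t) *: b].

(** A separation argument for a segment, made explicit. Put [u = xi - b] and
    [c = a - b]. Testing the component of [u] orthogonal to [c] against itself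
    shows that [u] is a multiple [t *: c]; the directions [c] and [- c] then give
    [t <= 1] and [0 <= t]. *)
Lemma segment_of_support a b xi :
  (forall d, dotv xi d <= Num.max (dotv a d) (dotv b d)) -> segment a b xi.
Proof.
move=> xi_le; set u := xi - b; set c := a - b.
have u_le d : dotv u d <= Num.max (dotv c d) 0.
  have := xi_le d; rewrite /u /c !dotvBl !le_max => /orP[]; first by lra.
  by move=> h; apply/orP; right; lra.
have segmentE t : u = t *: c -> xi = t *: a + (1 - t) *: b.
  move=> uE; rewrite -[LHS](subrK b) -/u uE scalerBr scalerBl scale1r.
  by rewrite -addrA [- _ + b]addrC.
clearbody u c; have [c0|c_neq0] := eqVneq (dotv c c) 0.
  exists 0; rewrite ?lexx ?ler01 //; apply: segmentE; rewrite scale0r.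
  apply: dotvv_le0; have := u_le u.
  by rewrite (dotvv_le0 (u := c)) ?c0 // dot0v maxxx.
have c_gt0 : 0 < dotv c c by rewrite lt_neqAle eq_sym c_neq0 dotvv_ge0.
set t := dotv u c / dotv c c.
have tc : t * dotv c c = dotv u c by rewrite divfK.
have uE : u = t *: c.
  apply/eqP; rewrite -subr_eq0; apply/eqP/dotvv_le0.
  have orth : dotv c (u - t *: c) = 0.
    by rewrite dotvBr dotvZr tc dotvC subrr.
  by have := u_le (u - t *: c); rewrite orth maxxx dotvBl dotvZl orth mulr0 subr0.
exists t; last exact: segmentE.
apply/andP; split.
  have := u_le (- c); rewrite !dotvNr le_max -tc.
  by move=> /orP[] h; rewrite -(ler_pM2r c_gt0); lra.
have := u_le c; rewrite le_max -tc => /orP[] h; rewrite -(ler_pM2r c_gt0); lra.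
Qed.

End DiniCalculus.

(** * Limiting subdifferentials of smooth functions, minima and maxima *)

Section SmoothSubdifferentials.
Context {R : realType} {n : nat}.
Implicit Types (phi psi : 'rV[R]_n -> R) (x z d xi : 'rV[R]_n).

Lemma differentiable_regular_subgradient phi x :
  differentiable phi x -> regular_subgradient phi x (grad phi x).
Proof.
move=> dphi e e0; have := grad_first_order dphi e0.
by apply: filterS => y; rewrite ler_norml => /andP[]; lra.
Qed.

Lemma regular_subgradient_minorant phi psi x xi : phi x = psi x ->
  (\forall y \near x, phi y <= psi y) ->
  regular_subgradient phi x xi -> regular_subgradient psi x xi.
Proof.
move=> phix phi_le xisub e e0; have := xisub _ e0; rewrite phix.
by apply: filterS2 phi_le => y /[swap]; exact: le_trans.
Qed.

Lemma near_ltr phi psi z : C1 phi -> C1 psi -> phi z < psi z ->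
  \forall y \near z, phi y < psi y.
Proof.
move=> /C1_continuous cphi /C1_continuous cpsi lt_z.
have : \forall y \near z, 0 < psi y - phi y.
  by apply: (cvgr_gt _ (cvgB (cpsi z) (cphi z))); rewrite subr_gt0.
by apply: filterS => y; rewrite subr_gt0.
Qed.

(** Near [z] all Dini subgradients of [psi] are gradients of [phi], which converge
    to [grad phi z] by continuity of the gradient. *)
Lemma limiting_subdiff_near phi psi z : C1 phi ->
  (\forall y \near z, psi y = phi y) ->
  limiting_subdiff psi z = [set grad phi z].
Proof.
move=> [dphi cphi] psiE; apply/seteqP; split=> xi; last first.
  move=> ->; apply: regular_subgradient_limiting.
  apply: regular_subgradient_minorant (differentiable_regular_subgradient (dphi z)).
    by rewrite (nbhs_singleton psiE).
  by apply: filterS psiE => y ->.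
move=> /limiting_subdiff_dini[x [u [xz uxi usub]]].
have gradz : grad phi (x k) @[k --> \oo] --> grad phi z.
  exact: (cvg_comp _ _ xz (cphi z)).
apply: (cvg_unique (@norm_hausdorff _ _) uxi); apply: cvg_trans _ gradz.
apply: near_eq_cvg; near=> k.
have psiEk : \forall y \near x k, psi y = phi y.
  by near: k; exact: xz _ (near_join psiE).
apply/esym/(@dini_subgradient_majorant _ _ phi psi (x k)) => //.
- exact: nbhs_singleton psiEk.
- by apply: filterS psiEk => y ->.
- by near: k.
Unshelve. all: by end_near. Qed.

Lemma limiting_subdiff_C1 phi z : C1 phi ->
  limiting_subdiff phi z = [set grad phi z].
Proof.
move=> phi_C1; apply: limiting_subdiff_near => //.
exact: near_always.
Qed.

End SmoothSubdifferentials.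

Section MinMax.
Context {R : realType} {n : nat}.
Variables G H : 'rV[R]_n -> R.
Hypotheses (G_C1 : C1 G) (H_C1 : C1 H).
Implicit Types (z : 'rV[R]_n).

(** Convex combinations of the two gradients are regular subgradients, because
    [max(G, H)] is above each convex combination of [G] and [H] and equals it
    at [z]. Conversely the upper Dini derivative of the maximum is at most the
    maximum of the two directional derivatives; in the limit this says that
    [xi] is below the support function of the segment. *)
Lemma limiting_subdiff_max_eq z : G z = H z ->
  limiting_subdiff (fun y => Num.max (G y) (H y)) z =
  segment (grad G z) (grad H z).
Proof.
move=> GH; have [[dG cG] [dH cH]] := (G_C1, H_C1).
apply/seteqP; split=> [xi|_ [t /andP[t0 t1] ->]]; last first.
  apply: regular_subgradient_limiting.
  have dtG : differentiable (fun y => t * G y) z by exact: (differentiableZ (f := G)).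
  have dtH : differentiable (fun y => (1 - t) * H y) z.
    exact: (differentiableZ (f := H)).
  rewrite -(gradZ _ (dG z)) -(gradZ _ (dH z)) -gradD //.
  apply: regular_subgradient_minorant; last first.
    by apply: differentiable_regular_subgradient; exact: differentiableD.
  - apply: near_always => y /=.
    have : t * G y <= t * Num.max (G y) (H y).
      by rewrite ler_wpM2l // le_max lexx.
    have : (1 - t) * H y <= (1 - t) * Num.max (G y) (H y).
      by rewrite ler_wpM2l ?subr_ge0 // le_max lexx orbT.
    lra.
  - by rewrite /= -GH maxxx; lra.
move=> /limiting_subdiff_dini[x [u [xz uxi usub]]].
apply: segment_of_support => d.
have support : \forall k \near \oo, dotv (u k) d <=
    Num.max (dotv (grad G (x k)) d) (dotv (grad H (x k)) d).
  near=> k; have uk : dini_subgradient (fun y => Num.max (G y) (H y)) (x k) (u k).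
    by near: k.
  have [GHk|HGk|eqk] := ltgtP (G (x k)) (H (x k)).
  - rewrite (dini_subgradient_majorant (dH _) _ _ uk) ?le_max ?lexx ?orbT //.
      by rewrite max_r // ltW.
    by apply: filterS (near_ltr G_C1 H_C1 GHk) => y /ltW /max_r ->.
  - rewrite (dini_subgradient_majorant (dG _) _ _ uk) ?le_max ?lexx //.
      by rewrite max_l // ltW.
    by apply: filterS (near_ltr H_C1 G_C1 HGk) => y /ltW /max_l ->.
  - by apply: uk; apply: upper_dini_max => //; exact: differentiable_upper_dini.
have cvgd (w : nat -> 'rV[R]_n) w0 : w @ \oo --> w0 ->
    dotv (w k) d @[k --> \oo] --> dotv w0 d.
  by move=> ww0; apply: cvg_dotv ww0 _; exact: cvg_cst.
apply: ler_cvg_to support; first exact: cvgd.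
apply: (@continuous2_cvg _ R R R _ _ _ _ Num.max).
- exact: (@max_continuous _ R (_, _)).
- by apply: cvgd; exact: (cvg_comp _ _ xz (cG z)).
- by apply: cvgd; exact: (cvg_comp _ _ xz (cH z)).
Unshelve. all: by end_near. Qed.

(** At every point [G] or [H] touches the minimum from above, so that Dini
    subgradients are gradients of [G] or of [H]. The product of the distances to
    these gradients vanishes along the sequence, hence in the limit, without
    selecting a subsequence on which one function is active. *)
Lemma limiting_subdiff_min_eq_sub z : G z = H z ->
  limiting_subdiff (fun y => Num.min (G y) (H y)) z `<=`
  [set grad G z; grad H z].
Proof.
move=> GH xi /limiting_subdiff_dini[x [u [xz uxi usub]]].
have [[dG cG] [dH cH]] := (G_C1, H_C1).
have : `|u k - grad G (x k)| * `|u k - grad H (x k)| @[k --> \oo] -->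
       `|xi - grad G z| * `|xi - grad H z|.
  apply: cvgM; apply: cvg_norm; apply: cvgB => //.
    exact: (cvg_comp _ _ xz (cG z)).
  exact: (cvg_comp _ _ xz (cH z)).
have prod0 : \forall k \near \oo,
    0 = `|u k - grad G (x k)| * `|u k - grad H (x k)|.
  near=> k; have uk : dini_subgradient (fun y => Num.min (G y) (H y)) (x k) (u k).
    by near: k.
  have [GHk|HGk] := leP (G (x k)) (H (x k)).
    rewrite (dini_subgradient_majorant (dG _) _ _ uk) ?subrr ?normr0 ?mul0r //.
      by rewrite min_l.
    by apply: near_always => y; rewrite ge_min lexx.
  rewrite (dini_subgradient_majorant (dH _) _ _ uk) ?subrr ?normr0 ?mulr0 //.
    by rewrite min_r // ltW.
  by apply: near_always => y; rewrite ge_min lexx orbT.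
move=> /(cvg_unique (@norm_hausdorff _ _)) prodE.
have /eqP : `|xi - grad G z| * `|xi - grad H z| = 0.
  by apply: prodE; apply: cvg_near_cst; apply: filterS prod0 => k <-.
by rewrite mulf_eq0 !normr_eq0 !subr_eq0 => /orP[] /eqP ->; [left|right].
Unshelve. all: by end_near. Qed.

(** If the gradients coincide, their common value is a regular subgradient of the
    minimum. Otherwise [H - G] grows strictly in direction
    [grad H z - grad G z], so that [z] is a limit of points with [G < H], where
    the minimum is locally [G]. *)
Lemma limiting_subdiff_min_eq_left z : G z = H z ->
  limiting_subdiff (fun y => Num.min (G y) (H y)) z (grad G z).
Proof.
move=> GH; have [[dG cG] [dH cH]] := (G_C1, H_C1).
have [gradE|/eqP grad_neq] := pselect (grad G z = grad H z).
  apply: regular_subgradient_limiting => e e0.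
  have Gsub := differentiable_regular_subgradient (dG z) e0.
  have := differentiable_regular_subgradient (dH z) e0.
  apply: filterS2 Gsub => y; rewrite -gradE -GH minxx => Gy Hy.
  by rewrite le_min Gy.
set d := grad H z - grad G z.
have d_gt0 : 0 < dotv d d.
  rewrite ltNge; apply/negP => /dotvv_le0 /eqP.
  by rewrite subr_eq0 eq_sym (negPf grad_neq).
have near_GH : \forall s \near (0 : R)^'+, G (z + s *: d) < H (z + s *: d).
  have Gd := differentiable_upper_dini d (dG z).
  (* A lower bound on [H] along the ray is an upper bound on [- H]; the slack
     [dotv d d / 4] spent twice leaves half of the slope [dotv d d]. *)
  have NHd := differentiable_upper_dini d (differentiableN (dH z)).
  rewrite gradN // dotvNl in NHd.
  have e0 : 0 < dotv d d / 4 by rewrite divr_gt0.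
  have dd : dotv d d = dotv (grad H z) d - dotv (grad G z) d by rewrite -dotvBl.
  near=> s; have s0 : 0 < s by near: s; exact: nbhs_right_gt.
  have : G (z + s *: d) <= G z + s * (dotv (grad G z) d + dotv d d / 4).
    by near: s; exact: Gd.
  have : - H (z + s *: d) <= - H z + s * (- dotv (grad H z) d + dotv d d / 4).
    by near: s; exact: NHd.
  have := mulr_gt0 s0 e0; rewrite GH; rewrite dd; lra.
have : forall k : nat, exists y, ball z k.+1%:R^-1 y /\ G y < H y.
  move=> k; have k0 : 0 < k.+1%:R^-1 :> R by rewrite invr_gt0 ltr0Sn.
  have [s [? ?]] := filter_ex (filterI (near_ray d (nbhsx_ballx z _ k0)) near_GH).
  by exists (z + s *: d).
move=> /choice[x xP].
have xz : x @ \oo --> z.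
  apply/cvgrPdist_lt => e e0; near=> k.
  have : ball z k.+1%:R^-1 (x k) := (xP k).1.
  rewrite -ball_normE /= => /lt_trans; apply.
  near: k; exact: (near_infty_natSinv_lt (PosNum e0)).
apply: (@cvg_regular_subgradient _ _ _ _ _ x (fun k => grad G (x k))) => //.
- have cmin : {for z, continuous (fun y => Num.min (G y) (H y))}.
    by apply: continuous_min; exact: C1_continuous.
  exact: (cvg_comp _ _ xz cmin).
- exact: (cvg_comp _ _ xz (cG z)).
- move=> k; apply: regular_subgradient_minorant (differentiable_regular_subgradient (dG _)).
    by rewrite min_l // ltW // (xP k).2.
  by apply: filterS (near_ltr G_C1 H_C1 (xP k).2) => y /ltW /min_l ->.
Unshelve. all: by end_near. Qed.

End MinMax.

Lemma limiting_subdiff_min_eq {R : realType} {n : nat} (G H : 'rV[R]_n -> R) z :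
  C1 G -> C1 H -> G z = H z ->
  limiting_subdiff (fun y => Num.min (G y) (H y)) z = [set grad G z; grad H z].
Proof.
move=> G_C1 H_C1 GH; apply/seteqP; split; first exact: limiting_subdiff_min_eq_sub.
move=> _ [] ->; first exact: limiting_subdiff_min_eq_left.
rewrite (_ : (fun y => _) = fun y => Num.min (H y) (G y)).
  exact: limiting_subdiff_min_eq_left.
by apply/funext => y; rewrite minC.
Qed.

(** * Clarke subdifferentials and multipliers of equality constraints *)

Section ConvexHulls.
Context {R : realType} {n : nat}.
Implicit Types a b : 'rV[R]_n.

Lemma convex_segment a b : @convex_set R 'rV[R]_n (segment a b).
Proof.
move=> _ _ l /set_mem[s /andP[s0 s1] ->] /set_mem[t /andP[t0 t1] ->]; apply/mem_set.
have l0 : 0 <= l%:num by [].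
have l1 : l%:num <= 1 by [].
exists (l%:num * s + (1 - l%:num) * t); first by apply/andP; split; nra.
transitivity (l%:num *: (s *: a + (1 - s) *: b) +
              (1 - l%:num) *: (t *: a + (1 - t) *: b)); first by [].
by apply/rowP => i; rewrite !mxE; ring.
Qed.

Lemma segment_left a b : segment a b a.
Proof. by exists 1; rewrite ?ler01 ?lexx // subrr scale0r scale1r addr0. Qed.

Lemma segment_right a b : segment a b b.
Proof. by exists 0; rewrite ?ler01 ?lexx // subr0 scale0r scale1r add0r. Qed.

Lemma segment_self a : segment a a = [set a].
Proof.
apply/seteqP; split=> [_ [t _ ->]|_ ->]; last exact: segment_left.
by rewrite /= -scalerDl addrC subrK scale1r.
Qed.

Lemma convex_hull_segment a b : convex_hull (segment a b) = segment a b.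
Proof. exact/smallest_id/convex_segment. Qed.

Lemma convex_hull_set1 a : convex_hull [set a] = [set a].
Proof. by rewrite -segment_self convex_hull_segment. Qed.

Lemma convex_hull_pair a b : convex_hull [set a; b] = segment a b.
Proof.
apply/seteqP; split.
  apply: smallest_sub; first exact: convex_segment.
  by move=> _ [] ->; [exact: segment_left|exact: segment_right].
move=> _ [t /andP[t0 t1] ->] A [convA subA].
have := convA a b (Itv01 t0 t1) (mem_set (subA a _)) (mem_set (subA b _)).
by move/(_ (or_introl erefl) (or_intror erefl))/set_mem.
Qed.

End ConvexHulls.

Section EqualityMultipliers.
Context {R : realType} {n : nat}.
Implicit Types (phi psi G H : 'rV[R]_n -> R) (z : 'rV[R]_n).
Implicit Types (sd : ('rV[R]_n -> R) -> 'rV[R]_n -> set 'rV[R]_n).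

(** The vectors that an equality constraint [psi = 0] can contribute to the
    A-stationarity condition for the subdifferential [sd]. *)
Definition equality_terms sd psi z : set 'rV[R]_n :=
  [set v | exists (la : R) (xi : 'rV[R]_n),
     [/\ 0 <= la, (sd psi z `|` sd (fun y => - psi y) z) xi & v = la *: xi]].

Definition gradient_pairs (biactive : R -> R -> Prop) G H z : set 'rV[R]_n :=
  [set v | exists a b : R, biactive a b /\ v = a *: grad G z + b *: grad H z].

(** This and [kink_consistent] are all that the equivalence uses of a
    subdifferential; they hold for the limiting and for the Clarke one, with
    different conditions [biactive]. *)
Definition locally_smooth_consistent sd : Prop :=
  forall phi psi z, C1 phi -> (\forall y \near z, psi y = phi y) ->
    sd psi z = [set grad phi z].

Definition kink_consistent sd (biactive : R -> R -> Prop) : Prop :=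
  forall G H z, C1 G -> C1 H -> G z = H z ->
    equality_terms sd (fun y => Num.min (G y) (H y)) z =
    gradient_pairs biactive G H z.

(** The multiplier condition at an iterate, without reference to the index sets
    at the limit point. *)
Definition active_multipliers (biactive : R -> R -> Prop) G H z (a b : R) : Prop :=
  [/\ G z < H z -> b = 0, G z > H z -> a = 0 & G z = H z -> biactive a b].

(** A nonnegative multiple of [- grad phi], available through [- psi], is an
    arbitrary nonpositive multiple of [grad phi]. *)
Lemma equality_terms_smooth sd phi psi z : locally_smooth_consistent sd ->
  C1 phi -> (\forall y \near z, psi y = phi y) ->
  equality_terms sd psi z = [set b *: grad phi z | b in setT].
Proof.
move=> sdC1 phiC1 psiE; rewrite /equality_terms (sdC1 _ _ _ phiC1 psiE).
have NpsiE : \forall y \near z, - psi y = - phi y by apply: filterS psiE => y ->.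
rewrite (sdC1 _ _ _ (C1N phiC1) NpsiE) (gradN (phiC1.1 z)).
apply/seteqP; split=> [_ [la [_ [_ [] -> ->]]]|_ [b _ <-]] /=.
- by exists la.
- by exists (- la); rewrite // scalerN scaleNr.
have [b0|/ltW b0] := leP 0 b.
  by exists b, (grad phi z); split=> //; left.
exists (- b), (- grad phi z); split; [by rewrite oppr_ge0|by right|].
by rewrite scalerN scaleNr opprK.
Qed.

Lemma equality_terms_min sd biactive G H z :
  locally_smooth_consistent sd -> kink_consistent sd biactive ->
  C1 G -> C1 H ->
  equality_terms sd (fun y => Num.min (G y) (H y)) z =
  gradient_pairs (active_multipliers biactive G H z) G H z.
Proof.
move=> sdC1 sdmin G_C1 H_C1.
have [GH|HG|GH] := ltgtP (G z) (H z).
- have minE : \forall y \near z, Num.min (G y) (H y) = G y.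
    by apply: filterS (near_ltr G_C1 H_C1 GH) => y /ltW /min_l.
  rewrite (equality_terms_smooth sdC1 G_C1 minE).
  apply/seteqP; split=> [_ [a _ <-]|_ [a [b [[b0 _ _] ->]]]].
    exists a, 0; rewrite scale0r addr0; split=> //; split=> //; lra.
  by exists a => //; rewrite b0 // scale0r addr0.
- have minE : \forall y \near z, Num.min (G y) (H y) = H y.
    by apply: filterS (near_ltr H_C1 G_C1 HG) => y /ltW /min_r.
  rewrite (equality_terms_smooth sdC1 H_C1 minE).
  apply/seteqP; split=> [_ [b _ <-]|_ [a [b [[_ a0 _] ->]]]].
    exists 0, b; rewrite scale0r add0r; split=> //; split=> //; lra.
  by exists b => //; rewrite a0 // scale0r add0r.
- rewrite sdmin //; apply/seteqP; split=> _ [a [b [ab ->]]]; exists a, b.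
    by split=> //; split=> //; rewrite GH ltxx.
  by case: ab => _ _ /(_ GH).
Qed.

Lemma limiting_locally_smooth_consistent :
  locally_smooth_consistent (@limiting_subdiff R n).
Proof. by move=> phi psi z; exact: limiting_subdiff_near. Qed.

Lemma clarke_locally_smooth_consistent :
  locally_smooth_consistent (@clarke_subdiff R n).
Proof.
move=> phi psi z phiC1 psiE.
by rewrite /clarke_subdiff (limiting_subdiff_near phiC1 psiE) convex_hull_set1.
Qed.

(** Taking [- psi] turns the minimum into a maximum, whose subdifferential is
    convex: this is the source of the asymmetry between the two signs. *)
Lemma limiting_subdiff_oppr_min_eq G H z : C1 G -> C1 H -> G z = H z ->
  limiting_subdiff (fun y => - Num.min (G y) (H y)) z =
  segment (- grad G z) (- grad H z).
Proof.
move=> G_C1 H_C1 GH.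
rewrite -(gradN (G_C1.1 z)) -(gradN (H_C1.1 z)).
rewrite -limiting_subdiff_max_eq ?GH //; do ?exact: C1N.
by congr limiting_subdiff; apply/funext => y; rewrite oppr_min.
Qed.

Lemma oppr_segment_terms (la t : R) (u v : 'rV[R]_n) :
  la *: (t *: - u + (1 - t) *: - v) = - (la * t) *: u + - (la * (1 - t)) *: v.
Proof. by apply/rowP => i; rewrite !mxE; ring. Qed.

Lemma segment_terms (la t : R) (u v : 'rV[R]_n) :
  la *: (t *: u + (1 - t) *: v) = (la * t) *: u + (la * (1 - t)) *: v.
Proof. by apply/rowP => i; rewrite !mxE; ring. Qed.

(** Normalizing by [- (a + b)] turns two nonpositive weights into the weights of a
    convex combination of [- u] and [- v]. *)
Lemma nonpositive_pair_terms (a b : R) (u v : 'rV[R]_n) : a <= 0 -> b <= 0 ->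
  exists (la : R) (xi : 'rV[R]_n), [/\ 0 <= la, segment (- u) (- v) xi &
     a *: u + b *: v = la *: xi].
Proof.
move=> a0 b0; have [ab0|ab_neq0] := eqVneq (a + b) 0.
  have [-> ->] : a = 0 /\ b = 0 by split; lra.
  exists 0, (- u); split=> //; first exact: segment_left.
  by rewrite !scale0r addr0.
have ab_lt0 : 0 < - (a + b) by rewrite oppr_gt0 lt_neqAle ab_neq0; lra.
pose t := - a / - (a + b).
have tE : - (a + b) * t = - a by rewrite mulrC divfK // gt_eqF.
exists (- (a + b)), (t *: - u + (1 - t) *: - v); split; first exact: ltW.
- exists t => //; rewrite divr_ge0 ?oppr_ge0 //=; last by lra.
  by rewrite ler_pdivrMr //; lra.
- by rewrite oppr_segment_terms mulrBr tE mulr1; congr (_ *: _ + _ *: _); lra.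
Qed.

(** Both segments are available here, and two reals have nonnegative product
    if and only if they are both nonpositive or both nonnegative. *)
Lemma clarke_kink_consistent :
  kink_consistent (@clarke_subdiff R n) nonneg_product.
Proof.
move=> G H z G_C1 H_C1 GH.
rewrite /equality_terms /clarke_subdiff limiting_subdiff_min_eq //.
rewrite limiting_subdiff_oppr_min_eq // convex_hull_pair convex_hull_segment.
apply/seteqP; split=> [_ [la [_ [la0 [] [t /andP[t0 t1] ->] ->]]]|_ [a [b [ab ->]]]].
- exists (la * t), (la * (1 - t)); rewrite segment_terms; split=> //.
  by rewrite /nonneg_product !mulr_ge0 // subr_ge0.
- exists (- (la * t)), (- (la * (1 - t))); rewrite oppr_segment_terms; split=> //.
  by rewrite /nonneg_product mulrNN !mulr_ge0 // subr_ge0.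
have [[a0 b0]|[a0 b0]] : (a <= 0 /\ b <= 0) \/ (- a <= 0 /\ - b <= 0).
- rewrite /nonneg_product in ab.
  have [a0|a0|->] := ltgtP a 0; have [b0|b0|->] := ltgtP b 0; try nra; lra.
- have [la [xi [la0 xiS ->]]] := nonpositive_pair_terms (grad G z) (grad H z) a0 b0.
  by exists la, xi; split=> //; right.
have [la [xi [la0 xiS xiE]]] := nonpositive_pair_terms (- grad G z) (- grad H z) a0 b0.
rewrite !opprK in xiS; exists la, xi; split=> //; first by left.
by rewrite -xiE !scalerN !scaleNr !opprK.
Qed.

(** The terms of [- min(G, H)] have both multipliers nonpositive; those of
    [min(G, H)] involve a single gradient, and one gradient can carry a
    multiplier of any sign. *)
Lemma limiting_kink_consistent :
  kink_consistent (@limiting_subdiff R n) both_negative_or_zero_product.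
Proof.
move=> G H z G_C1 H_C1 GH.
rewrite /equality_terms limiting_subdiff_min_eq // limiting_subdiff_oppr_min_eq //.
apply/seteqP; split.
  move=> _ [la [_ [la0 [[] -> | [t /andP[t0 t1] ->]] ->]]].
  - by exists la, 0; rewrite scale0r addr0; split=> //; right; rewrite mulr0.
  - by exists 0, la; rewrite scale0r add0r; split=> //; right; rewrite mul0r.
  - exists (- (la * t)), (- (la * (1 - t))); rewrite oppr_segment_terms; split=> //.
    have [->|a_neq0] := eqVneq (la * t) 0; first by right; rewrite oppr0 mul0r.
    have [->|b_neq0] := eqVneq (la * (1 - t)) 0; first by right; rewrite oppr0 mulr0.
    left; rewrite !oppr_lt0 !lt_neqAle !(eq_sym 0) a_neq0 b_neq0.
    by rewrite !mulr_ge0 // subr_ge0.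
have one_term (b : R) (v : 'rV[R]_n) : [set grad G z; grad H z] v ->
    exists (la : R) (xi : 'rV[R]_n), [/\ 0 <= la,
      ([set grad G z; grad H z] `|` segment (- grad G z) (- grad H z)) xi &
      b *: v = la *: xi].
  move=> v_grad; have [b0|/ltW b0] := leP 0 b.
    by exists b, v; split=> //; left.
  exists (- b), (- v); rewrite scalerN scaleNr opprK oppr_ge0; split=> //; right.
  by case: v_grad => ->; [exact: segment_left|exact: segment_right].
move=> _ [a [b [ab ->]]].
case: ab => [[/ltW a0 /ltW b0]|/eqP].
  have [la [xi [la0 xiS ->]]] := nonpositive_pair_terms (grad G z) (grad H z) a0 b0.
  by exists la, xi; split=> //; right.
rewrite mulf_eq0 => /orP[] /eqP ->; rewrite scale0r ?add0r ?addr0.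
  by apply: one_term; right.
by apply: one_term; left.
Qed.

End EqualityMultipliers.

(** * Stationarity of the reformulation and of the complementarity problem *)

Section LagrangianGradient.
Context {R : realType} {n : nat}.
Implicit Types (x z : 'rV[R]_n).

Lemma differentiable_lincomb m (c : 'I_m -> R) (phi : 'I_m -> 'rV[R]_n -> R) x :
  (forall i, differentiable (phi i) x) ->
  differentiable (fun y => \sum_i c i * phi i y) x.
Proof.
move=> dphi; rewrite (_ : (fun y => _) = \sum_i (c i \*: phi i)).
  by apply: differentiable_sum => i; exact: differentiableZ.
by apply/funext => y; rewrite fct_sumE.
Qed.

Lemma grad_lincomb m (c : 'I_m -> R) (phi : 'I_m -> 'rV[R]_n -> R) x :
  (forall i, differentiable (phi i) x) ->
  grad (fun y => \sum_i c i * phi i y) x = \sum_i c i *: grad (phi i) x.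
Proof.
move=> dphi; rewrite (_ : (fun y => _) = \sum_i (c i \*: phi i)); last first.
  by apply/funext => y; rewrite fct_sumE.
apply/rowP => j; rewrite !(mxE, summxE) derive_sum => [|i]; last first.
  by apply: derivableZ; exact: diff_derivable.
by apply: eq_bigr => i _; rewrite deriveZ ?mxE //; exact: diff_derivable.
Qed.

Lemma grad_lagrangian mg mh mcc (f : 'rV[R]_n -> R) (g : 'I_mg -> 'rV[R]_n -> R)
    (h : 'I_mh -> 'rV[R]_n -> R) (G H : 'I_mcc -> 'rV[R]_n -> R)
    (lg : 'rV[R]_mg) (lh : 'rV[R]_mh) (lG lH : 'rV[R]_mcc) z :
  C1 f -> (forall i, C1 (g i)) -> (forall i, C1 (h i)) ->
  (forall i, C1 (G i)) -> (forall i, C1 (H i)) ->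
  grad (fun y => mpcc_lagrangian f g h G H y lg lh lG lH) z =
  grad f z + \sum_i lg 0 i *: grad (g i) z + \sum_i lh 0 i *: grad (h i) z
    + \sum_i (lG 0 i *: grad (G i) z + lH 0 i *: grad (H i) z).
Proof.
move=> [df _] dg dh dG dH.
have d m (c : 'rV[R]_m) (phi : 'I_m -> 'rV[R]_n -> R) : (forall i, C1 (phi i)) ->
    differentiable (fun y => \sum_i c 0 i * phi i y) z.
  by move=> dphi; apply: differentiable_lincomb => i; exact: (dphi i).1.
have dfg := differentiableD (df z) (d _ lg g dg).
have dfgh := differentiableD dfg (d _ lh h dh).
have dfghG := differentiableD dfgh (d _ lG G dG).
rewrite (gradD dfghG (d _ lH H dH)) (gradD dfgh (d _ lG G dG)).
rewrite (gradD dfg (d _ lh h dh)) (gradD (df z) (d _ lg g dg)).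
rewrite !grad_lincomb; do ?[by move=> i; exact: (dg i).1
  | by move=> i; exact: (dh i).1 | by move=> i; exact: (dG i).1
  | by move=> i; exact: (dH i).1].
by rewrite big_split /= addrA.
Qed.

End LagrangianGradient.

Section Reformulation.
Context {R : realType} {n mg mh mcc : nat}.
Variables (f : 'rV[R]_n -> R) (g : 'I_mg -> 'rV[R]_n -> R)
          (h : 'I_mh -> 'rV[R]_n -> R) (G H : 'I_mcc -> 'rV[R]_n -> R).
Hypotheses (f_C1 : C1 f) (g_C1 : forall i, C1 (g i)) (h_C1 : forall i, C1 (h i))
           (G_C1 : forall i, C1 (G i)) (H_C1 : forall i, C1 (H i)).
Variables (sd : ('rV[R]_n -> R) -> 'rV[R]_n -> set 'rV[R]_n)
          (biactive : R -> R -> Prop).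
Hypotheses (sd_smooth : locally_smooth_consistent sd)
           (sd_kink : kink_consistent sd biactive).
Implicit Types (z zbar eps : 'rV[R]_n).

Let P : problem n mg (mh + mcc) := reformulation f g h G H.

Lemma eqty_lshift (i : 'I_mh) : eqty P (lshift mcc i) = h i.
Proof. by rewrite /= (unsplitK (inl i)). Qed.

Lemma eqty_rshift (i : 'I_mcc) :
  eqty P (rshift mh i) = fun z => Num.min (G i z) (H i z).
Proof. by rewrite /= (unsplitK (inr i)). Qed.

(** The condition at one iterate in [asymptotically_stationary], isolated so that
    the two stationarity systems can be compared pointwise. *)
Definition stationary_at zbar z eps (lI : 'rV[R]_mg) (lJ : 'rV[R]_(mh + mcc)) :=
  [/\ exists (xi0 : 'rV[R]_n) (xiI : 'I_mg -> 'rV[R]_n)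
             (xiJ : 'I_(mh + mcc) -> 'rV[R]_n),
        [/\ limiting_subdiff (objective P) z xi0,
            forall i, sd (ineq P i) z (xiI i),
            forall j, (sd (eqty P j) z `|` sd (fun y => - eqty P j y) z) (xiJ j) &
            eps = xi0 + \sum_(i < mg) lI 0 i *: xiI i
                      + \sum_(j < mh + mcc) lJ 0 j *: xiJ j],
      forall i, Num.min (lI 0 i) (- ineq P i zbar) = 0 &
      forall j, 0 <= lJ 0 j].

(** Unlike the conditions in [mpcc_sequences], the multiplier conditions here do
    not refer to the index sets at [zbar]; they are related to these by
    [active_multipliers_mpcc]. *)
Definition mpcc_stationary_at zbar z eps (lg : 'rV[R]_mg) (lh : 'rV[R]_mh)
    (lG lH : 'rV[R]_mcc) :=
  [/\ eps = grad (fun y => mpcc_lagrangian f g h G H y lg lh lG lH) z,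
      forall i, Num.min (lg 0 i) (- g i zbar) = 0 &
      forall i, active_multipliers biactive (G i) (H i) z (lG 0 i) (lH 0 i)].

Lemma sd_C1 phi z : C1 phi -> sd phi z = [set grad phi z].
Proof. by move=> phi_C1; apply: sd_smooth => //; exact: near_always. Qed.

Lemma equality_terms_C1 phi z : C1 phi ->
  equality_terms sd phi z = [set b *: grad phi z | b in setT].
Proof.
by move=> phi_C1; apply: equality_terms_smooth => //; exact: near_always.
Qed.

(** Each term of the sum over the equality constraints lies in the
    corresponding [equality_terms], which provides the multipliers. *)
Lemma mpcc_stationary_at_of zbar z eps lI lJ : stationary_at zbar z eps lI lJ ->
  exists lh lG lH, mpcc_stationary_at zbar z eps lI lh lG lH.
Proof.
case=> [[xi0 [xiI [xiJ [xi0f xiIg xiJP epsE]]]] lI_compl lJ_ge0].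
have termJ j : equality_terms sd (eqty P j) z (lJ 0 j *: xiJ j).
  by exists (lJ 0 j), (xiJ j).
have /choice[b bP] : forall i : 'I_mh, exists b : R,
    lJ 0 (lshift mcc i) *: xiJ (lshift mcc i) = b *: grad (h i) z.
  move=> i; have := termJ (lshift mcc i).
  by rewrite eqty_lshift equality_terms_C1 // => -[b _ <-]; exists b.
have /choice[ab abP] : forall i : 'I_mcc, exists ab : R * R,
    active_multipliers biactive (G i) (H i) z ab.1 ab.2 /\
    lJ 0 (rshift mh i) *: xiJ (rshift mh i) =
      ab.1 *: grad (G i) z + ab.2 *: grad (H i) z.
  move=> i; have := termJ (rshift mh i).
  rewrite eqty_rshift (equality_terms_min _ sd_smooth sd_kink) //.
  by case=> a [b' [abP ->]]; exists (a, b').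
exists (\row_i b i), (\row_i (ab i).1), (\row_i (ab i).2); split=> //.
- rewrite epsE grad_lagrangian // big_split_ord /= addrA.
  have -> : xi0 = grad f z by move: xi0f; rewrite limiting_subdiff_C1.
  congr (_ + _ + _ + _); apply: eq_bigr => i _.
  + by have := xiIg i; rewrite sd_C1 // => ->.
  + by rewrite bP mxE.
  + by rewrite (abP i).2 !mxE.
- by move=> i; rewrite !mxE; exact: (abP i).1.
Qed.

Lemma stationary_at_of_mpcc zbar z eps lg lh lG lH :
  mpcc_stationary_at zbar z eps lg lh lG lH ->
  exists lJ, stationary_at zbar z eps lg lJ.
Proof.
case=> epsE lg_compl lGH.
have /choice[b bP] : forall i : 'I_mh, exists lx : R * 'rV[R]_n,
    [/\ 0 <= lx.1, (sd (h i) z `|` sd (fun y => - h i y) z) lx.2 &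
        lh 0 i *: grad (h i) z = lx.1 *: lx.2].
  move=> i; have : equality_terms sd (h i) z (lh 0 i *: grad (h i) z).
    by rewrite equality_terms_C1 //; exists (lh 0 i).
  by case=> la [xi ?]; exists (la, xi).
have /choice[c cP] : forall i : 'I_mcc, exists lx : R * 'rV[R]_n,
    [/\ 0 <= lx.1,
        (sd (fun y => Num.min (G i y) (H i y)) z `|`
         sd (fun y => - Num.min (G i y) (H i y)) z) lx.2 &
        lG 0 i *: grad (G i) z + lH 0 i *: grad (H i) z = lx.1 *: lx.2].
  move=> i; have : equality_terms sd (fun y => Num.min (G i y) (H i y)) z
      (lG 0 i *: grad (G i) z + lH 0 i *: grad (H i) z).
    rewrite (equality_terms_min _ sd_smooth sd_kink) //.
    by exists (lG 0 i), (lH 0 i); split.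
  by case=> la [xi ?]; exists (la, xi).
pose lx j := match fintype.split j with inl i => b i | inr i => c i end.
have lxl i : lx (lshift mcc i) = b i by rewrite /lx (unsplitK (inl i)).
have lxr i : lx (rshift mh i) = c i by rewrite /lx (unsplitK (inr i)).
exists (\row_j (lx j).1); split=> //.
- exists (grad f z), (fun i => grad (g i) z), (fun j => (lx j).2); split.
  + by rewrite limiting_subdiff_C1.
  + by move=> i; rewrite sd_C1.
  + move=> j; case: (split_ordP j) => i ->.
      by rewrite eqty_lshift lxl; case: (bP i).
    by rewrite eqty_rshift lxr; case: (cP i).
  + rewrite epsE grad_lagrangian // big_split_ord /= addrA.
    congr (_ + _ + _); apply: eq_bigr => i _; rewrite mxE.
      by rewrite lxl; case: (bP i).
    by rewrite lxr; case: (cP i).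
- by move=> j; rewrite mxE; case: (split_ordP j) => i ->;
    rewrite ?lxl ?lxr; [case: (bP i)|case: (cP i)].
Qed.

Lemma reformulation_feasible z : mpcc_feasible g h G H z -> feasible P z.
Proof.
case=> g_le0 h_eq0 GH; split=> // j; case: (split_ordP j) => i ->.
  by rewrite eqty_lshift.
rewrite eqty_rshift; have [G0 H0 /eqP] := GH i.
by rewrite mulf_eq0 => /orP[] /eqP e; rewrite e in G0 H0 *; [rewrite min_l|rewrite min_r].
Qed.

Lemma index_trichotomy zbar i : mpcc_feasible g h G H zbar ->
  [\/ I_p0 G H zbar i, I_0p G H zbar i | I_00 G H zbar i].
Proof.
case=> _ _ /(_ i) [G0 H0 /eqP]; rewrite mulf_eq0 => /orP[] /eqP e.
  have [H_gt0|H_le0] := ltP 0 (H i zbar); first by apply: Or32.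
  by apply: Or33; split=> //; apply/le_anti; rewrite H_le0.
have [G_gt0|G_le0] := ltP 0 (G i zbar); first by apply: Or31.
by apply: Or33; split=> //; apply/le_anti; rewrite G_le0.
Qed.

(** The strict inequality between [G i] and [H i] at [zbar] persists nearby, and
    there are finitely many indices. *)
Lemma near_inactive_order zbar : \forall z \near zbar, forall i,
  (I_p0 G H zbar i -> H i z < G i z) /\ (I_0p G H zbar i -> G i z < H i z).
Proof.
apply: (@filter_forall _ _ _ _ (nbhs_filter zbar)) => i.
have [p0|np0] := pselect (I_p0 G H zbar i).
  have HG : H i zbar < G i zbar by rewrite p0.2 p0.1.
  apply: filterS (near_ltr (H_C1 i) (G_C1 i) HG) => z HGz; split=> // -[G0 _].
  by have := p0.1; rewrite G0 ltxx.
have [op|nop] := pselect (I_0p G H zbar i).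
  have GH : G i zbar < H i zbar by rewrite op.1 op.2.
  by apply: filterS (near_ltr (G_C1 i) (H_C1 i) GH) => z GHz; split.
by apply: near_always => z; split.
Qed.

(** At an index where exactly one of [G i], [H i] vanishes at [zbar], the order at
    [z] selects the multiplier that has to vanish, and it is the one that the
    index set prescribes; the remaining clauses are void. *)
Lemma active_multipliers_mpcc zbar z (lG lH : 'rV[R]_mcc) :
  mpcc_feasible g h G H zbar ->
  (forall i, (I_p0 G H zbar i -> H i z < G i z) /\
             (I_0p G H zbar i -> G i z < H i z)) ->
  (forall i, active_multipliers biactive (G i) (H i) z (lG 0 i) (lH 0 i)) <->
  [/\ forall i, I_p0 G H zbar i -> lG 0 i = 0,
      forall i, I_0p G H zbar i -> lH 0 i = 0 &
      forall i, I_00 G H zbar i ->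
        active_multipliers biactive (G i) (H i) z (lG 0 i) (lH 0 i)].
Proof.
move=> feas order; split=> [act|[lG0 lH0 act] i].
  split=> i Ii //; have [lHz lGz _] := act i.
    by apply: lGz; exact: (order i).1.
  by apply: lHz; exact: (order i).2.
have [p0|op|] := index_trichotomy i feas; last exact: act.
  have HG := (order i).1 p0; split=> [|_|]; [lra|exact: lG0|lra].
have GH := (order i).2 op; split=> [_||]; [exact: lH0|lra|lra].
Qed.

(** Shifting the sequences past the iterates not covered by
    [near_inactive_order] makes the two systems equivalent at every iterate. *)
Theorem asymptotically_stationary_mpcc zbar : mpcc_feasible g h G H zbar ->
  asymptotically_stationary sd P zbar <->
  exists (z eps : nat -> 'rV[R]_n) (lg : nat -> 'rV[R]_mg) (lh : nat -> 'rV[R]_mh)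
         (lG lH : nat -> 'rV[R]_mcc),
    mpcc_sequences f g h G H biactive zbar z eps lg lh lG lH.
Proof.
move=> feas.
have tail (z : nat -> 'rV[R]_n) : z @ \oo --> zbar -> exists N : nat,
    forall k i, (I_p0 G H zbar i -> H i (z (k + N)%N) < G i (z (k + N)%N)) /\
                (I_0p G H zbar i -> G i (z (k + N)%N) < H i (z (k + N)%N)).
  move=> zz; have [N _ NP] := zz _ (near_inactive_order zbar).
  by exists N => k; apply: NP => /=; exact: leq_addl.
split.
  case=> _ [z [eps [lI [lJ [zz eps0 stat]]]]].
  have [N order] := tail z zz.
  have /choice[l lP] : forall k : nat, exists l : 'rV[R]_mh * 'rV[R]_mcc * 'rV[R]_mcc,
      mpcc_stationary_at zbar (z (k + N)%N) (eps (k + N)%N) (lI (k + N)%N)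
        l.1.1 l.1.2 l.2.
    move=> k; have [lh [lG [lH st]]] := mpcc_stationary_at_of (stat (k + N)%N).
    by exists (lh, lG, lH).
  exists (fun k => z (k + N)%N), (fun k => eps (k + N)%N), (fun k => lI (k + N)%N).
  exists (fun k => (l k).1.1), (fun k => (l k).1.2), (fun k => (l k).2).
  split; [by rewrite cvg_shiftn|by rewrite cvg_shiftn|move=> k].
  have [-> compl /(active_multipliers_mpcc _ _ feas (order k))[? ? act]] := lP k.
  by split.
case=> z [eps [lg [lh [lG [lH [zz eps0 stat]]]]]].
split; first exact: reformulation_feasible.
have [N order] := tail z zz.
have /choice[lJ lJP] : forall k : nat, exists lJ,
    stationary_at zbar (z (k + N)%N) (eps (k + N)%N) (lg (k + N)%N) lJ.
  move=> k; have [epsE compl lG0 lH0 act] := stat (k + N)%N.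
  apply: (@stationary_at_of_mpcc _ _ _ _ (lh (k + N)%N) (lG (k + N)%N) (lH (k + N)%N)).
  by split=> //; apply/(active_multipliers_mpcc _ _ feas (order k)).
exists (fun k => z (k + N)%N), (fun k => eps (k + N)%N), (fun k => lg (k + N)%N), lJ.
by split; rewrite ?cvg_shiftn.
Qed.

(** Where [G i] and [H i] differ, one of the multipliers vanishes, and both
    conditions of interest accept pairs with a zero entry. *)
Lemma mpcc_sequences_biactive zbar (z eps : nat -> 'rV[R]_n)
    (lg : nat -> 'rV[R]_mg) (lh : nat -> 'rV[R]_mh) (lG lH : nat -> 'rV[R]_mcc) :
  (forall a b, a = 0 \/ b = 0 -> biactive a b) ->
  mpcc_sequences f g h G H biactive zbar z eps lg lh lG lH ->
  forall k i, I_00 G H zbar i -> biactive (lG k 0 i) (lH k 0 i).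
Proof.
move=> biactive0 [_ _ stat] k i i00; have [_ _ _ _ /(_ i i00) [GH HG eqGH]] := stat k.
have [/GH lH0|/HG lG0|/eqGH //] := ltgtP (G i (z k)) (H i (z k)).
  by apply: biactive0; right.
by apply: biactive0; left.
Qed.

End Reformulation.

Theorem proposition4p1 (R : realType) (n mg mh mcc : nat) (mcc_gt0 : (0 < mcc)%N)
    (f : 'rV[R]_n -> R) (g : 'I_mg -> 'rV[R]_n -> R)
    (h : 'I_mh -> 'rV[R]_n -> R) (G H : 'I_mcc -> 'rV[R]_n -> R)
    (zbar : 'rV[R]_n)
    (f_C1 : C1 f) (g_C1 : forall i, C1 (g i)) (h_C1 : forall i, C1 (h i))
    (G_C1 : forall i, C1 (G i)) (H_C1 : forall i, C1 (H i))
    (zbar_feasible : mpcc_feasible g h G H zbar) :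
  ((asymptotically_stationary clarke_subdiff (reformulation f g h G H) zbar <->
    exists (z eps : nat -> 'rV[R]_n)
           (lg : nat -> 'rV[R]_mg) (lh : nat -> 'rV[R]_mh)
           (lG lH : nat -> 'rV[R]_mcc),
      mpcc_sequences f g h G H nonneg_product zbar z eps lg lh lG lH)
   /\
   (forall (z eps : nat -> 'rV[R]_n)
           (lg : nat -> 'rV[R]_mg) (lh : nat -> 'rV[R]_mh)
           (lG lH : nat -> 'rV[R]_mcc),
      mpcc_sequences f g h G H nonneg_product zbar z eps lg lh lG lH ->
      forall (k : nat) (i : 'I_mcc), I_00 G H zbar i ->
        0 <= lG k 0 i * lH k 0 i))
  /\
  ((asymptotically_stationary limiting_subdiff (reformulation f g h G H) zbar <->
    exists (z eps : nat -> 'rV[R]_n)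
           (lg : nat -> 'rV[R]_mg) (lh : nat -> 'rV[R]_mh)
           (lG lH : nat -> 'rV[R]_mcc),
      mpcc_sequences f g h G H both_negative_or_zero_product zbar
        z eps lg lh lG lH)
   /\
   (forall (z eps : nat -> 'rV[R]_n)
           (lg : nat -> 'rV[R]_mg) (lh : nat -> 'rV[R]_mh)
           (lG lH : nat -> 'rV[R]_mcc),
      mpcc_sequences f g h G H both_negative_or_zero_product zbar
        z eps lg lh lG lH ->
      forall (k : nat) (i : 'I_mcc), I_00 G H zbar i ->
        (lG k 0 i < 0 /\ lH k 0 i < 0) \/ lG k 0 i * lH k 0 i = 0)).
Proof.
have nonneg0 (a b : R) : a = 0 \/ b = 0 -> nonneg_product a b.
  by rewrite /nonneg_product => -[] ->; rewrite ?mul0r ?mulr0.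
have negative0 (a b : R) : a = 0 \/ b = 0 -> both_negative_or_zero_product a b.
  by case=> ->; right; rewrite ?mul0r ?mulr0.
split; split.
- apply: asymptotically_stationary_mpcc => //.
    exact: clarke_locally_smooth_consistent.
  exact: clarke_kink_consistent.
- by move=> z eps lg lh lG lH seqs; exact: mpcc_sequences_biactive seqs.
- apply: asymptotically_stationary_mpcc => //.
    exact: limiting_locally_smooth_consistent.
  exact: limiting_kink_consistent.
- by move=> z eps lg lh lG lH seqs; exact: mpcc_sequences_biactive seqs.
Qed.
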